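(* Fix $d\ge3$. The minimum degree of $\mathcal{D}_{d-1}(\mathbb{Q}^d)$ is at least $2^{d}/d^4$, and each connected component of $\mathcal{D}_{d-1}(\mathbb{Q}^d)$ contains at least $2^{2^{d}/d^4}$ dimer configurations.
   Context: $\mathbb{Q}^d$ is the unit hypercube graph with vertex set $\{1,2\}^d$, two vertices adjacent iff they differ in exactly one coordinate. A dimer configuration on a graph $G$ is a perfect matching; its edges are dimers. An alternating cycle is a cycle of even length in which every second edge is a dimer; switching it exchanges dimer and non-dimer edges along the cycle. For $\ell\ge 2$, $\mathcal{D}_\ell(G)$ is the graph on dimer configurations of $G$ in which two configurations are adjacent if one is obtained from the other by switching an alternating cycle of length at most $2\ell$. *)

(* Defs.v *)
From HB Require Import structures.
From mathcomp Require Import all_boot.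

Set Implicit Arguments.
Unset Strict Implicit.
Unset Printing Implicit Defensive.

(* A finite simple graph is a symmetric irreflexive adjacency relation on a   *)
(* finType.                                                                   *)

Section Graphs.
Variables (T : finType) (e : rel T).

Definition degree (x : T) : nat := #|[set y | e x y]|.

(* The unit #|T| of the minimum exceeds every degree of a nonempty simple     *)
(* graph, so it plays no role there.                                          *)
Definition min_degree : nat := \big[minn/#|T|]_(x : T) degree x.

Definition components : {set {set T}} :=
  equivalence_partition (connect e) [set: T].

Definition edges : {set {set T}} :=
  [set [set p.1; p.2] | p in [set p : T * T | e p.1 p.2]].

Definition is_dimer_config (M : {set {set T}}) : bool :=
  (M \subset edges) && [forall v : T, #|[set a in M | v \in a]| == 1].

Record dimer_config : Type := DimerConfig {
  dimers : {set {set T}};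
  dimersP : is_dimer_config dimers }.
HB.instance Definition _ := [isSub for dimers].
HB.instance Definition _ := [Finite of dimer_config by <:].

(* c lists the successive vertices of the cycle, so that size c is its length *)
Definition is_cycle (c : seq T) : bool := (3 <= size c) && ucycleb e c.

Definition cycle_edges (c : seq T) : seq {set T} :=
  [seq [set x; next c x] | x <- c].

(* The boolean b tells whether the dimers are required at the odd or at the   *)
(* even positions of c.                                                       *)
Definition alternating (M : {set {set T}}) (c : seq T) : bool :=
  ~~ odd (size c) &&
  [exists b : bool, [forall i : 'I_(size c),
     (odd i == b) ==> (nth set0 (cycle_edges c) i \in M)]].

Definition switch (M : {set {set T}}) (c : seq T) : {set {set T}} :=
  (M :\: [set:: cycle_edges c]) :|: ([set:: cycle_edges c] :\: M).

Definition dimer_graph (l : nat) : rel dimer_config := fun M N =>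
  [exists n : 'I_(2 * l).+1, [exists c : n.-tuple T,
     [&& is_cycle c, alternating (dimers M) c & dimers N == switch (dimers M) c]]].

Lemma dimer_graphP (l : nat) (M N : dimer_config) :
  reflect (exists c : seq T, [/\ size c <= 2 * l, is_cycle c,
             alternating (dimers M) c & dimers N = switch (dimers M) c])
          (dimer_graph l M N).
Proof.
apply: (iffP existsP) => [[n /existsP[c /and3P[cc ac /eqP sc]]]|[c [sz cc ac sc]]].
  by exists c; split=> //; rewrite size_tuple -ltnS.
exists (Ordinal (sz : size c < (2 * l).+1)); apply/existsP; exists (in_tuple c).
by rewrite cc ac sc /=.
Qed.

Lemma in_switch (M : {set {set T}}) (c : seq T) (a : {set T}) :
  (a \in switch M c) = (a \in M) (+) (a \in cycle_edges c).
Proof. by rewrite !inE; case: (a \in M); case: (a \in cycle_edges c). Qed.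

Lemma dimer_graph_irr (l : nat) : irreflexive (dimer_graph l).
Proof.
move=> M; apply/negbTE/negP => /dimer_graphP[c [_ /andP[sz _] _ /setP sc]].
case: c sz sc => [//|x c] _ /(_ [set x; next (x :: c) x]).
rewrite in_switch (_ : _ \in cycle_edges _); last exact: mem_head.
by rewrite addbT; case: (_ \in _).
Qed.

Lemma dimer_uniq (M : dimer_config) (v : T) (a b : {set T}) :
  a \in dimers M -> b \in dimers M -> v \in a -> v \in b -> a = b.
Proof.
case: M => M /= /andP[_ /forallP/(_ v)/cards1P[z /setP Mz]] aM bM va vb.
have := Mz a; have := Mz b; rewrite !inE aM bM va vb /=.
by move=> /esym/eqP -> /esym/eqP ->.
Qed.

Lemma nth_cycle_edges (x0 : T) (c : seq T) (i : nat) : uniq c -> i < size c ->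
  nth set0 (cycle_edges c) i = [set nth x0 c i; nth x0 c (i.+1 %% size c)].
Proof.
move=> uc ltic; rewrite (nth_map x0) // next_nth mem_nth //.
case: c uc ltic => [//|y c] uc ltic; rewrite index_uniq //.
move: (ltic); rewrite leq_eqVlt => /predU1P[/= eqi|/= lti].
  by case: eqi => ->; rewrite modnn [nth y c _]nth_default.
by rewrite modn_small //= (set_nth_default x0).
Qed.

Lemma dimer_graph_sym (l : nat) : symmetric (dimer_graph l).
Proof.
suff H M N : dimer_graph l M N -> dimer_graph l N M by move=> M N; apply/idP/idP; apply: H.
move=> /dimer_graphP[c [sz cc ac sc]]; apply/dimer_graphP; exists c; split=> //; last first.
  by apply/setP=> a; rewrite in_switch sc in_switch -addbA addbb addbF.
case/andP: cc ac => c3 /andP[_ uc] /andP[ev /existsP[b /forallP bM]].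
rewrite /alternating ev; apply/existsP; exists (~~ b); apply/forallP=> i; apply/implyP=> oi.
have c0 : 0 < size c by apply: leq_trans c3.
have [x0 _] : exists x0, x0 \in c by case: (c) c0 => // x s _; exists x; rewrite mem_head.
rewrite sc in_switch mem_nth ?size_map // addbT.
set n := size c in ev i oi c3 c0 bM *.
pose j := (i + n.-1) %% n.
have jn : j < n by rewrite ltn_mod.
have ji : j.+1 %% n = i.
  rewrite /j -addn1 modnDml -addnA addn1 prednK // modnDr modn_small //.
have oj : odd j == b.
  have: odd (j.+1 %% n) = odd j.+1 by rewrite [in RHS](divn_eq j.+1 n) oddD oddM (negbTE ev) andbF.
  by rewrite ji (eqP oi) /= => /negb_inj ->.
have := bM (Ordinal jn); rewrite /= oj /= => jM.
apply/negP => iM.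
have := dimer_uniq (v := nth x0 c i) jM iM.
rewrite !(nth_cycle_edges x0) ?ji // set21 set22 => /(_ isT isT) /setP/(_ (nth x0 c j)).
rewrite !inE eqxx /= => /esym /orP[].
all: rewrite nth_uniq ?ltn_mod // => /eqP E.
  have := ji; rewrite E -/n => /eqP; have := ltn_ord i; rewrite leq_eqVlt => /predU1P[F|F].
    by rewrite F modnn => /eqP G; rewrite -F -G in c3.
  by rewrite modn_small // eqn_leq ltnn.
have := ji; rewrite E -/n -addn1 modnDml addn1 => /eqP.
rewrite -[X in _ == X](modn_small (ltn_ord i)) -{2}[nat_of_ord i]addn0 -addn2 eqn_modDl.
by rewrite mod0n modn_small.
Qed.

End Graphs.

Arguments dimer_graph {T} e l M N.

(* The coordinate values 1 and 2 are encoded as false and true.               *)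
Definition hypercube (d : nat) : rel {ffun 'I_d -> bool} := fun x y =>
  #|[set i | x i != y i]| == 1.

Arguments hypercube d x y : clear implicits.

Lemma hypercube_sym (d : nat) : symmetric (hypercube d).
Proof.
by move=> x y; congr (_ == 1); apply: eq_card => i; rewrite !inE eq_sym.
Qed.

Lemma hypercube_irr (d : nat) : irreflexive (hypercube d).
Proof.
move=> x; rewrite /hypercube (_ : [set _ | _] = set0) ?cards0 //.
by apply/setP=> i; rewrite !inE eqxx.
Qed.

(* Main.v *)
(* Fix a dimer configuration and a vertex v, let i0 be the direction of the
   dimer at v and f i that of the dimer at v+e_i. If f i = i0 for some i <> i0,
   the parallel dimers at v and v+e_i form an alternating 4-cycle. Otherwise f
   is a fixed-point-free map of the d-1 directions other than i0, and a cycle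
   i1, ..., ik of f gives the alternating cycle v+e_i1, v+e_i1+e_i2, v+e_i2,
   v+e_i2+e_i3, ... of length 2k <= 2(d-1). In both cases the cycle lies in the
   ball of radius 2 around v. A maximal set S of vertices at mutual distances at
   least 5 has at least 2^d/d^4 elements, since balls of radius 4 have at most
   d^4 vertices, and the cycles attached to the elements of S are disjoint:
   they can be switched independently. *)
Require Import Defs.
From mathcomp Require Import all_boot all_order all_algebra.
From mathcomp Require Import reals exp.
From mathcomp Require Import zify.

(** * Dimer configurations as involutions on the vertices *)

Section Dimers.
Set Implicit Arguments.
Unset Strict Implicit.
Variables (T : finType) (e : rel T).
Hypothesis e_sym : symmetric e.
Implicit Types (M N : dimer_config e) (c s : seq T) (p : T -> T).

Lemma dimer_partner M : exists p, [/\ involutive p, forall x, e x (p x)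
  & forall x, [set x; p x] \in dimers M].
Proof.
have /fin_all_exists[p pP] x : exists y, e x y /\ [set x; y] \in dimers M.
  case: M => D /= /andP[/subsetP sD /forallP/(_ x)/cards1P[a /setP Da]].
  have := Da a; rewrite !inE eqxx => /andP[aD xa].
  have /imsetP[[y z]] := sD _ aD; rewrite inE /= => eyz defa.
  move: xa aD; rewrite defa !inE => /orP[]/eqP-> aD; first by exists z.
  by exists y; rewrite e_sym setUC.
exists p; split=> x; [|exact: (pP x).1|exact: (pP x).2].
(* The dimers chosen at [x] and at [p x] share the vertex [p x], so they coincide. *)
have /setP/(_ x) : [set x; p x] = [set p x; p (p x)].
  by apply: (dimer_uniq (v := p x) (pP x).2 (pP _).2); rewrite !inE eqxx ?orbT.
by rewrite !inE eqxx => /esym/orP[]/eqP xE; rewrite -?xE.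
Qed.

Lemma dimer_config_of_involution p : involutive p -> (forall x, e x (p x)) ->
  is_dimer_config e [set [set x; p x] | x : T].
Proof.
move=> pK ep; apply/andP; split.
  apply/subsetP=> _ /imsetP[x _ ->]; apply/imsetP.
  by exists (x, p x) => //; rewrite inE /= ep.
apply/forallP=> v; apply/cards1P; exists [set v; p v]; apply/setP=> a.
rewrite !inE; apply/andP/eqP => [[/imsetP[x _ ->]]|->]; last first.
  by rewrite set21; split=> //; apply: imset_f.
by rewrite !inE => /orP[]/eqP-> //; rewrite pK setUC.
Qed.

(** * Alternating cycles from lists of vertices and their partners *)

Definition weave p s := flatten [seq [:: x; p x] | x <- s].

Lemma size_weave p s : size (weave p s) = 2 * size s.
Proof. by elim: s => //= x s; rewrite /weave /= => ->; rewrite mulnS. Qed.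

Lemma mem_weave p s y :
  (y \in weave p s) = (y \in s) || (y \in [seq p x | x <- s]).
Proof.
elim: s => // x s IH; rewrite /weave /= !inE -/(weave p s) IH.
by case: (y == x) (y == p x) (y \in s) => [] [] [].
Qed.

Lemma nth_weave p s x0 i : i < size s ->
  nth x0 (weave p s) i.*2 = nth x0 s i /\
  nth x0 (weave p s) i.*2.+1 = p (nth x0 s i).
Proof. by elim: s i => // x s IH [|i] //= /IH. Qed.

Lemma uniq_weave p s : injective p -> uniq s ->
  (forall x, x \in s -> p x \notin s) -> uniq (weave p s).
Proof.
move=> p_inj us ps.
have: forall x, x \in [seq p x | x <- s] -> x \notin s.
  by move=> _ /mapP[x xs ->]; apply: ps.
elim: s us {ps} => // x s IH /= /andP[xs us] ps.
have H y : y \in map p s -> (y != x) && (y \notin s).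
  by move=> ys; have := ps y; rewrite !inE ys orbT negb_or; apply.
rewrite /weave /= -/(weave p s) IH // ?andbT; last by move=> y /H/andP[].
have := ps (p x); rewrite !inE eqxx negb_or => /(_ isT)/andP[pxx pxs].
rewrite !mem_weave eq_sym (negbTE pxx) (negbTE xs) (negbTE pxs) /=.
rewrite (mem_map p_inj) (negbTE xs) andbT.
by apply/negP=> /H; rewrite eqxx.
Qed.

(** The edges from [x] to [p x] come from [ep], so only the steps from a partner to the next entry
    of [s] have to be checked. *)
Lemma cycle_weave p s : (forall x, e x (p x)) ->
  cycle (fun x y => e (p x) y) s -> cycle e (weave p s).
Proof.
move=> ep; case: s => // x s; rewrite /weave /= ep /=.
have: forall z y, path (fun x y => e (p x) y) z (rcons s y) ->
  path e (p z) (rcons (weave p s) y).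
  by elim: s => //= a s IH z y /andP[-> /IH]; rewrite /= ep.
by move=> H /H.
Qed.

Lemma alternating_weave (D : {set {set T}}) p s : uniq (weave p s) ->
  (forall x, [set x; p x] \in D) -> alternating D (weave p s).
Proof.
move=> us pD; rewrite /alternating size_weave oddM /=.
apply/existsP; exists false; apply/forallP=> -[i /= lti]; apply/implyP=> /eqP oi.
have [x0 _] : exists x0, x0 \in s by case: (s) lti => // x ? _; exists x; exact: mem_head.
have iE : i = i./2.*2 by rewrite -[LHS]odd_double_half oi.
have lti2 : i./2 < size s by lia.
(* An even [i] is never the last position of the weave, so [i.+1] does not wrap around. *)
rewrite (nth_cycle_edges x0) ?size_weave // modn_small; last by lia.
by rewrite iE; case: (nth_weave p x0 lti2) => -> ->.
Qed.

(** * Positions on a cycle, and switching along it *)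

Lemma index_next c x : uniq c -> x \in c ->
  index (next c x) c = (index x c).+1 %% size c.
Proof.
move=> uc xc; have ltx : index x c < size c by rewrite index_mem.
rewrite next_nth xc; case: c uc xc ltx => // z c uc xc.
set i := index x _ => /=; rewrite ltnS leq_eqVlt => /predU1P[->|lti].
  (* At the last vertex [nth] falls back on its default, the head, whose index is 0. *)
  by rewrite nth_default // modnn /= eqxx.
rewrite modn_small ?ltnS //.
exact: (index_uniq z (s := z :: c) (i := i.+1)).
Qed.

(** The two cycle edges at a vertex have positions of opposite parity, also across the end of the
    list because the length is even. *)
Lemma alternating_next_prev (D : {set {set T}}) c x : alternating D c -> uniq c ->
  x \in c -> [set x; next c x] \in D \/ [set prev c x; x] \in D.
Proof.
case/andP=> ev /existsP[b /forallP bD] uc xc.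
set n := size c in ev bD.
have ltx : index x c < n by rewrite index_mem.
have n0 : 0 < n by apply: leq_ltn_trans ltx.
have bD' y : y \in c -> odd (index y c) == b -> [set y; next c y] \in D.
  move=> yc oy; have lty : index y c < n by rewrite index_mem.
  by have := bD (Ordinal lty); rewrite /= oy (nth_map x) ?nth_index //; exact.
have [ox|nox] := boolP (odd (index x c) == b); first by left; apply: bD'.
right; rewrite -{2}[x](next_prev uc); apply: bD'; first by rewrite mem_prev.
set y := prev c x; have yc : y \in c by rewrite mem_prev.
have lty : index y c < n by rewrite index_mem.
have ix : index x c = (index y c).+1 %% n by rewrite -index_next // next_prev.
have: odd ((index y c).+1 %% n) = odd (index y c).+1.
  by rewrite [in RHS](divn_eq (index y c).+1 n) oddD oddM (negbTE ev) andbF.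
by move=> E; move: nox; rewrite ix E /=; case: (odd _) (b) => [] [].
Qed.

(** A shift by one or two positions modulo a length of at least 3 never returns to the start. Hence
    the two cycle edges at a vertex are different. *)
Lemma next_neq c x : uniq c -> 3 <= size c -> x \in c ->
  next c x != x /\ next c (next c x) != x.
Proof.
move=> uc c3 xc.
have ltx : index x c < size c by rewrite index_mem.
have n1 := index_next uc xc.
have n2 : index (next c (next c x)) c = (index (next c x) c).+1 %% size c.
  by rewrite index_next ?mem_next.
have sz i : i < size c -> i.+1 %% size c = if i.+1 == size c then 0 else i.+1.
  by case: eqP => [->|?]; rewrite ?modnn // => ?; rewrite modn_small //; lia.
have lty : index (next c x) c < size c by rewrite index_mem mem_next.
move: n1 n2; rewrite !sz // => n1 n2.
by split; apply/eqP=> E; move: n1 n2; rewrite ?E; do ?(case: (_.+1 =P _) => ?); lia.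
Qed.

Lemma mem_cycle_edges c a : a \in cycle_edges c ->
  exists2 x, x \in c & a = [set x; next c x].
Proof. by case/mapP=> x; exists x. Qed.

Lemma cycle_edges_sub c a x : a \in cycle_edges c -> x \in a -> x \in c.
Proof.
by case/mem_cycle_edges=> y yc ->; rewrite !inE => /orP[]/eqP->; rewrite ?mem_next.
Qed.

(** Off the cycle nothing changes. At a vertex of the cycle exactly one of its two cycle edges is a
    dimer: at least one by alternation, at most one because dimers are disjoint. Switching exchanges
    the two. *)
Lemma switch_dimer_config M c : is_cycle e c -> alternating (dimers M) c ->
  is_dimer_config e (switch (dimers M) c).
Proof.
case/andP=> c3 /andP[ec uc] ac; apply/andP; split.
  apply/subsetP=> a; rewrite in_switch; case: (boolP (a \in dimers M)) => [aM _|_].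
    by case: M {ac} aM => D /= /andP[/subsetP sD _]; apply: sD.
  case: (boolP (a \in cycle_edges c)) => // /mem_cycle_edges[x xc ->] _.
  by apply/imsetP; exists (x, next c x); rewrite // inE; apply: next_cycle.
apply/forallP=> v; have [vc|vc] := boolP (v \in c); last first.
  case: (M) => D /= /andP[_ /forallP/(_ v)/eqP Dv]; rewrite -Dv; apply/eqP.
  apply: eq_card => a; rewrite inE [RHS]inE in_switch.
  have [va|] := boolP (v \in a); last by rewrite !andbF.
  have /negbTE-> : a \notin cycle_edges c; last by rewrite addbF.
  by apply: contra vc => /cycle_edges_sub; apply.
(* [b] is the old dimer at [v], and [b'] is the other cycle edge, which becomes the new dimer. *)
suff [b [b' [bM b'M bb']]] : exists b b', [/\ b \in dimers M, b' \notin dimers M &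
    forall a : {set T}, (v \in a) && (a \in cycle_edges c) = (a == b) || (a == b')].
  apply/cards1P; exists b'; apply/setP=> a; rewrite inE in_switch inE.
  have vb : v \in b by have := bb' b; rewrite eqxx => /andP[].
  have [va|va] := boolP (v \in a); last first.
    by have := bb' a; rewrite (negbTE va) => /esym/norP[_ /negbTE->]; rewrite andbF.
  have := bb' a; rewrite va andbT => /= ->.
  have [->|anb] /= := eqVneq a b; first by rewrite bM; case: eqP b'M => // <-; rewrite bM.
  suff /negbTE-> : a \notin dimers M by [].
  by apply: contra anb => aM; rewrite (dimer_uniq aM bM va vb).
have pc : prev c v \in c by rewrite mem_prev.
have [pv ppv] := next_neq uc c3 pc; rewrite (next_prev uc) in pv ppv.
have [nv _] := next_neq uc c3 vc.
set a1 := [set v; next c v]; set a2 := [set prev c v; v].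
have va1 : v \in a1 by rewrite set21.
have va2 : v \in a2 by rewrite set22.
have a12 : a1 != a2.
  apply/eqP=> /setP/(_ (next c v)); rewrite !inE eqxx orbT.
  by rewrite (negbTE nv) (negbTE ppv).
have a12E (a : {set T}) : (v \in a) && (a \in cycle_edges c) = (a == a1) || (a == a2).
  apply/andP/orP=> [[va /mem_cycle_edges[x xc ax]]|].
    move: va; rewrite ax !inE => /orP[]/eqP vx; [left|right]; rewrite /a1 /a2 vx //.
    by rewrite (prev_next uc).
  case=> /eqP->; split=> //; apply/mapP; first by exists v.
  by exists (prev c v); rewrite ?next_prev.
case: (alternating_next_prev ac uc vc) => aM; [exists a1, a2|exists a2, a1].
  split=> //; apply: contra a12 => a2M.
  by apply/eqP; apply: (dimer_uniq aM a2M va1 va2).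
split=> // [|a]; last by rewrite orbC.
by apply: contra a12 => a1M; apply/eqP; apply: (dimer_uniq a1M aM va1 va2).
Qed.

(** This keeps a cycle alternating after other cycles, sharing no edge with it, have been
    switched. *)
Lemma alternating_sub (D D' : {set {set T}}) c :
  {in cycle_edges c, forall a, a \in D -> a \in D'} ->
  alternating D c -> alternating D' c.
Proof.
move=> DD' /andP[ev /existsP[b /forallP bD]]; rewrite /alternating ev.
apply/existsP; exists b; apply/forallP=> i; apply/implyP=> oi.
by apply: DD'; [rewrite mem_nth ?size_map | have := bD i; rewrite oi].
Qed.

(** * Independent switches along disjoint cycles *)

Section Family.
Variables (I : finType) (c : I -> seq T) (l : nat) (M : dimer_config e) (S : {set I}).
Hypothesis cP : {in S, forall i,
  [/\ size (c i) <= 2 * l, is_cycle e (c i) & alternating (dimers M) (c i)]}.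
Hypothesis c_disj :
  {in S &, forall i j, i != j -> forall x, x \in c i -> x \notin c j}.

Lemma cycle_edges_disj (i j : I) a : i \in S -> j \in S ->
  a \in cycle_edges (c i) -> a \in cycle_edges (c j) -> i = j.
Proof.
move=> iS jS ai aj; case: (mem_cycle_edges ai) => x xi ax.
apply: contraTeq xi => ij; apply/negP=> /(c_disj iS jS ij)/negP; apply.
by apply: cycle_edges_sub aj _; rewrite ax set21.
Qed.

(** The cycles are switched one after another, by induction on [#|A|]. Each stays alternating
    because the earlier switches leave its edges untouched. *)
Lemma switch_family (A : {set I}) : A \subset S ->
  exists2 N, connect (dimer_graph e l) M N & forall a,
    (a \in dimers N) = (a \in dimers M) (+) [exists i in A, a \in cycle_edges (c i)].
Proof.
have [n] := ubnP #|A|; elim: n A => // n IH A An AS.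
have [->|[i iA]] := set_0Vmem A.
  exists M => // a; case: existsP => [[i]|_]; last by rewrite addbF.
  by rewrite inE.
have [||N MN NE] := IH (A :\ i); first by move: An; rewrite (cardsD1 i) iA.
  exact: subset_trans (subD1set _ _) AS.
have iS : i \in S by apply: (subsetP AS).
have [sz ci ai] := cP iS.
have aN : alternating (dimers N) (c i).
  apply: alternating_sub ai => a aci aM; rewrite NE aM.
  suff /negbTE-> : ~~ [exists j in A :\ i, a \in cycle_edges (c j)] by [].
  apply/existsP=> -[j]; rewrite !inE => /andP[/andP[ji jA] aj].
  by rewrite (cycle_edges_disj (subsetP AS _ jA) iS aj aci) eqxx in ji.
exists (DimerConfig (switch_dimer_config ci aN)).
  apply: connect_trans MN (connect1 _); apply/dimer_graphP.
  by exists (c i).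
(* At most one of the cycles contains [a], so the existential over [A] splits as an exclusive or. *)
move=> a; rewrite in_switch NE -addbA; congr addb.
have [aci|aci] := boolP (a \in cycle_edges (c i)).
  have -> : [exists j in A, a \in cycle_edges (c j)].
    by apply/existsP; exists i; rewrite iA.
  suff /negbTE-> : ~~ [exists j in A :\ i, a \in cycle_edges (c j)] by [].
  apply/existsP=> -[j]; rewrite !inE => /andP[/andP[ji jA] aj].
  by rewrite (cycle_edges_disj (subsetP AS _ jA) iS aj aci) eqxx in ji.
rewrite addbF; apply: eq_existsb => j; rewrite !inE.
by have [->|] := eqVneq j i; rewrite // iA (negbTE aci).
Qed.

(* As the cycles are edge-disjoint, one edge of each of them tells whether it
   has been switched. *)
Definition switched N : {set I} := [set i in S |
  (head set0 (cycle_edges (c i)) \in dimers N) !=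
  (head set0 (cycle_edges (c i)) \in dimers M)].

Lemma switchedE N (A : {set I}) : A \subset S ->
  (forall a, (a \in dimers N) =
    (a \in dimers M) (+) [exists i in A, a \in cycle_edges (c i)]) ->
  switched N = A.
Proof.
move=> AS NE; apply/setP=> i; rewrite inE.
have [iS|] := boolP (i \in S); last by move/(contra (subsetP AS i))/negbTE.
(* A cycle is nonempty, so [head] does not return its default [set0]. *)
have hi : head set0 (cycle_edges (c i)) \in cycle_edges (c i).
  by have [_ /andP[+ _] _] := cP iS; case: (c i) => //= x s _; rewrite mem_head.
rewrite NE /=; have -> : [exists j in A, head set0 (cycle_edges (c i)) \in cycle_edges (c j)] = (i \in A).
  apply/existsP/idP => [[j /andP[jA hj]]|iA]; last by exists i; rewrite iA.
  by rewrite (cycle_edges_disj iS (subsetP AS _ jA) hi hj).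
by case: (i \in A) (_ \in dimers M) => [] [].
Qed.

(** Every singleton [[set i]] with [i] in [S] is the value of [switched] at some neighbour of [M],
    which forces at least [#|S|] neighbours. *)
Lemma degree_ge_family : #|S| <= degree (dimer_graph e l) M.
Proof.
rewrite -(card_imset S (@set1_inj I)).
apply: leq_trans (leq_imset_card switched _); apply: subset_leq_card.
apply/subsetP=> _ /imsetP[i iS ->]; have [sz ci ai] := cP iS.
apply/imsetP; exists (DimerConfig (switch_dimer_config ci ai)).
  by rewrite inE; apply/dimer_graphP; exists (c i).
rewrite (switchedE (A := [set i])) ?sub1set // => a; rewrite in_switch; congr addb.
apply/idP/existsP => [aci|[j]]; first by exists i; rewrite set11.
by rewrite inE => /andP[/eqP->].
Qed.

(** Likewise, every subset of [S] is a value of [switched] on the component of [M]. *)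
Lemma component_ge_family :
  2 ^ #|S| <= #|[set N | connect (dimer_graph e l) M N]|.
Proof.
rewrite -card_powerset; apply: leq_trans (leq_imset_card switched _).
apply: subset_leq_card; apply/subsetP=> A; rewrite inE => AS.
have [N MN NE] := switch_family AS.
by apply/imsetP; exists N; rewrite ?inE // (switchedE AS NE).
Qed.

End Family.
End Dimers.

(** * Flips and Hamming distance in the cube *)

Section Hypercube.
Variable d : nat.
Local Notation V := {ffun 'I_d -> bool}.
Implicit Types (x y z v : V) (i j : 'I_d).

Definition flip x i : V := [ffun j => x j (+) (j == i)].

Definition hdist x y : nat := #|[set i | x i != y i]|.

Lemma hdistC x y : hdist x y = hdist y x.
Proof. by apply: eq_card => i; rewrite !inE eq_sym. Qed.

Lemma hdist_triangle y x z : hdist x z <= hdist x y + hdist y z.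
Proof.
apply: leq_trans (leq_card_setU _ _); apply: subset_leq_card.
by apply/subsetP=> i; rewrite !inE; case: (x i) (y i) (z i) => [] [] [].
Qed.

Lemma hdistxx x : hdist x x = 0.
Proof. by apply/eqP; rewrite cards_eq0; apply/eqP/setP=> i; rewrite !inE eqxx. Qed.

Lemma hypercube_flip x i : hypercube d x (flip x i).
Proof.
apply/cards1P; exists i; apply/setP=> j; rewrite !inE ffunE.
by case: (x j) (j == i) => [] [].
Qed.

Lemma hdist_flip x i : hdist x (flip x i) = 1.
Proof. exact/eqP/hypercube_flip. Qed.

Lemma hypercube_adj x y : hypercube d x y -> exists i, y = flip x i.
Proof.
move=> /cards1P[i /setP xy]; exists i; apply/ffunP=> j; rewrite ffunE.
by have := xy j; rewrite !inE; case: (x j) (y j) (j == i) => [] [] [].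
Qed.

Lemma flipK x i : flip (flip x i) i = x.
Proof. by apply/ffunP=> j; rewrite !ffunE -addbA addbb addbF. Qed.

Lemma flipC x i j : flip (flip x i) j = flip (flip x j) i.
Proof. by apply/ffunP=> k; rewrite !ffunE -!addbA (addbC (k == i)). Qed.

Lemma flip_inj x : injective (flip x).
Proof.
move=> i j /ffunP/(_ i); rewrite !ffunE eqxx.
by case: eqP => //; case: (x i).
Qed.

Lemma flip_neq x i : flip x i != x.
Proof. by apply/eqP=> /ffunP/(_ i); rewrite ffunE eqxx; case: (x i). Qed.

(** The left side differs from [x] in the two coordinates [i] and [j], the right side only in
    [k]. *)
Lemma flip2_neq x i j k : i != j -> flip (flip x i) j != flip x k.
Proof.
move=> ij; apply/eqP=> /ffunP E; have := E i; have := E j; rewrite !ffunE !eqxx.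
rewrite (negbTE ij) [j == i]eq_sym (negbTE ij).
have [->|_] := eqVneq k i; first by rewrite [j == i]eq_sym (negbTE ij); case: (x j).
by case: (x i).
Qed.

Lemma hdist_flip2 x i j : hdist x (flip (flip x i) j) <= 2.
Proof. by apply: leq_trans (hdist_triangle (flip x i) _ _) _; rewrite !hdist_flip. Qed.

(** * A short alternating cycle near a given vertex *)

Lemma exists_fcycle (U : finType) (f : U -> U) (a : U) : exists s : seq U,
  [/\ uniq s, fcycle f s, 0 < size s & forall b, b \in s -> exists n, b = iter n f a].
Proof.
(* As [f] need not be injective, the orbit of [a] may be a tail followed by a loop. After
   [order f a] steps it returns to the earlier position [j]; the loop is the part from [j] on. *)
have /trajectP[j ltj jE] := looping_order f a.
have us : uniq (traject f (iter j f a) (order f a - j)).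
  have: uniq (traject f a (j + (order f a - j))) by rewrite subnKC ?orbit_uniq // ltnW.
  by rewrite trajectD cat_uniq => /and3P[].
have m0 : 0 < order f a - j by rewrite subn_gt0.
exists (traject f (iter j f a) (order f a - j)); split=> //; last 2 first.
- by rewrite size_traject.
- by move=> b /trajectP[n _ ->]; exists (n + j); rewrite iterD.
have bE : iter (order f a - j) f (iter j f a) = iter j f a.
  by rewrite -iterD subnK // ltnW.
move: (iter j f a) (order f a - j) bE m0 => b [//|m] bE _ /=.
by rewrite -{3}bE iterSr -trajectSr fpath_traject.
Qed.

Lemma local_cycle (M : dimer_config (hypercube d)) v : 3 <= d ->
  exists c, [/\ size c <= 2 * (d - 1), is_cycle (hypercube d) c,
    alternating (dimers M) c & forall x, x \in c -> hdist v x <= 2].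
Proof.
move=> d3; have [p [pK ep pM]] := dimer_partner (@hypercube_sym d) M.
have /fin_all_exists[dir dirP] x : exists i, p x = flip x i by apply: hypercube_adj.
have p_inj := inv_inj pK.
have weaveP s : uniq s -> (forall x, x \in s -> p x \notin s) -> 2 <= size s ->
    cycle (fun x y => hypercube d (p x) y) s ->
    is_cycle (hypercube d) (weave p s) /\ alternating (dimers M) (weave p s).
  move=> us ps s2 cs; have uw := uniq_weave p_inj us ps; split.
    rewrite /is_cycle size_weave /ucycleb uw andbT cycle_weave // andbT.
    exact: leq_trans (leq_mul (leqnn 2) s2).
  exact: alternating_weave.
set i0 := dir v; pose f i := dir (flip v i).
have pf i : p (flip v i) = flip (flip v i) (f i) by apply: dirP.
have pv : p v = flip v i0 by apply: dirP.
have [/existsP[i /andP[ii0 /eqP fi]]|/existsPn fA] := boolP [exists i, (i != i0) && (f i == i0)].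
  (* [y] is the corner opposite [v] in a square: the weave runs through [v], [v+e_i0], [v+e_i+e_i0],
     [v+e_i]. *)
  pose y := p (flip v i); have yE : y = flip (flip v i) i0 by rewrite /y pf fi.
  have py : p y = flip v i by rewrite /y pK.
  have [||||ci ai] := weaveP [:: v; y].
  - rewrite /= inE andbT yE; apply: contra ii0 => /eqP E.
    by apply/eqP/(@flip_inj v); rewrite {2}E flipK.
  - move=> x; rewrite !inE => /orP[]/eqP->; rewrite ?pv ?py yE negb_or flip_neq /=.
      by rewrite eq_sym flip2_neq.
    by rewrite eq_sym flip2_neq.
  - by [].
  - by rewrite /= pv py yE (hypercube_sym _ v) flipC !hypercube_flip.
  (* The length 4 is at most [2 * (d - 1)] because [3 <= d]. *)
  exists (weave p [:: v; y]); split=> //; first by rewrite size_weave /=; lia.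
  move=> x; rewrite mem_weave !inE pv py yE.
  by case/orP=> /orP[]/eqP->; rewrite ?hdistxx ?hdist_flip ?hdist_flip2.
have fP i : i != i0 -> f i != i0 by move=> ii0; have := fA i; rewrite ii0.
(* If [f i = i], then [v+e_i] is matched with [v], whose partner is [v+e_i0]. *)
have f_neq i : i != i0 -> f i != i.
  move=> ii0; apply: contra ii0 => /eqP fi; have := pf i; rewrite fi flipK.
  by move/(congr1 p); rewrite pK pv => /flip_inj->.
have [i1 i1i0] : exists i, i != i0.
  have : 0 < #|[set~ i0]| by rewrite cardsC1 card_ord; lia.
  by case/card_gt0P=> i; rewrite !inE; exists i.
have [s [us fs s0 sA]] := exists_fcycle f i1.
have si0 i : i \in s -> i != i0.
  by case/sA=> n ->; elim: n => //= n; apply: fP.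
(* A loop of length 1 would be a fixed point of [f]. *)
have s2 : 2 <= size s.
  case: s us fs s0 si0 {sA} => // i [|//] _ /= /andP[/eqP fi _] _ /(_ i).
  by rewrite mem_head => /(_ isT)/f_neq; rewrite fi eqxx.
(* The directions in [s] are distinct and avoid [i0]; this gives the bound on the length. *)
have sd : size s <= d - 1.
  have := uniq_leq_size us (s2 := enum [set~ i0]).
  rewrite -cardE cardsC1 card_ord subn1; apply=> i /si0.
  by rewrite mem_enum !inE.
have [||||ci ai] := weaveP (map (flip v) s).
- by rewrite map_inj_uniq //; apply: flip_inj.
- move=> _ /mapP[i /si0 ii0 ->]; rewrite pf; apply/negP=> /mapP[j _ /eqP].
  by apply/negP/flip2_neq; rewrite eq_sym f_neq.
- by rewrite size_map.
(* The partner [v+e_i+e_(f i)] of [v+e_i] is adjacent to the next entry [v+e_(f i)], from which it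
   differs in direction [i]. *)
- rewrite cycle_map; apply: sub_cycle fs => i _ /eqP <- /=.
  by rewrite pf flipC hypercube_sym hypercube_flip.
exists (weave p (map (flip v) s)); split=> //.
  by rewrite size_weave size_map leq_mul2l sd.
move=> x; rewrite mem_weave => /orP[/mapP[i _ ->]|/mapP[_ /mapP[i _ ->] ->]].
  by rewrite hdist_flip.
by rewrite pf hdist_flip2.
Qed.

(** * Packing the cube with balls *)

Lemma ffact_leq_expn n k : n ^_ k <= n ^ k.
Proof.
by elim: k => // k IH; rewrite ffactnSr expnSr leq_mul ?leq_subr.
Qed.

(** A vertex is determined by the set of coordinates where it differs from [v], so the ball injects
    into the subsets of size at most 4. *)
Lemma card_ball v : 3 <= d -> #|[set x | hdist v x <= 4]| <= d ^ 4.
Proof.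
move=> d3; have dinj : injective (fun x => [set i | v i != x i]).
  move=> x y /setP E; apply/ffunP=> i; have := E i; rewrite !inE.
  by case: (v i) (x i) (y i) => [] [] [].
rewrite -(card_imset _ dinj).
apply: (@leq_trans (\sum_(k < 5) 'C(d, k))).
  under eq_bigr => k _ do rewrite -[X in 'C(X, _)]card_ord -card_draws -sum1_card.
  rewrite -sum1_card; under [leqRHS]eq_bigr => k _ do rewrite big_mkcond /=.
  rewrite exchange_big big_mkcond /=; apply: leq_sum => A _.
  case: imsetP => // -[x]; rewrite inE -ltnS => Ax AE.
  by rewrite (bigD1 (Ordinal Ax)) //= inE AE eqxx.
(* Remaining: 1 + d + d^2/2 + d^3/6 + d^4/24 is at most d^4. Since [3 <= d], each power is at least
   three times the previous one, and the claim is linear in the powers. *)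
have C k : 'C(d, k) * k`! <= d ^ k by rewrite bin_ffact ffact_leq_expn.
have := (C 2, C 3, C 4); rewrite !big_ord_recr big_ord0 /= bin0 bin1.
rewrite !factS fact0 => -[[C2 C3] C4].
have S k : 3 * d ^ k <= d ^ k.+1 by rewrite expnS leq_mul2r d3 orbT.
have := (S 1, S 2, S 3); rewrite expn1 => -[[S1 S2] S3]; lia.
Qed.

(** In a maximal set with these distances, the balls of radius 4 cover the cube, since an uncovered
    vertex could be added. Counting pairs of a centre and a vertex in its ball gives the bound. *)
Lemma exists_code : 3 <= d -> exists S : {set V},
  2 ^ d <= #|S| * d ^ 4 /\ {in S &, forall x y, x != y -> 4 < hdist x y}.
Proof.
move=> d3.
pose P (S : {set V}) := [forall x in S, forall y in S, (x != y) ==> (4 < hdist x y)].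
have PP (S : {set V}) : reflect {in S &, forall x y, x != y -> 4 < hdist x y} (P S).
  apply: (iffP forall_inP) => [H x y xS yS xy|H x xS].
    by have /forall_inP/(_ y yS)/implyP := H x xS; apply.
  by apply/forall_inP=> y yS; apply/implyP; apply: H.
have [|S /maxsetP[/PP SP Smax]] := @ex_maxset _ P.
  by exists set0; apply/PP=> x y; rewrite inE.
exists S; split=> //.
have cov x : exists2 y, y \in S & hdist y x <= 4.
  have [/exists_inP//|/exists_inPn far] := boolP [exists y in S, hdist y x <= 4].
  have xS : x \in S.
    rewrite -(Smax (x |: S)) ?setU11 ?subsetUr //; apply/PP=> y z.
    rewrite !inE => /predU1P[->|yS] /predU1P[->|zS]; rewrite ?eqxx //.
    - by rewrite hdistC ltnNge far.
    - by rewrite ltnNge far.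
    exact: SP.
  by have := far x xS; rewrite hdistxx.
have -> : 2 ^ d = #|V| by rewrite card_ffun card_bool card_ord.
rewrite -[#|V|]sum1_card -sum_nat_const.
apply: (@leq_trans (\sum_(x : V) \sum_(y in S) (hdist y x <= 4))).
  apply: leq_sum => x _; have [y yS yx] := cov x.
  by rewrite (bigD1 y) //= yx.
rewrite exchange_big; apply: leq_sum => y _.
apply: leq_trans (card_ball y d3); rewrite -sum1_card [leqRHS]big_mkcond.
by apply: leq_sum => x _; rewrite inE; case: ifP.
Qed.

(** All edges in one direction form a dimer configuration, so at least one configuration exists. *)
Lemma parallel_dimer_config i :
  is_dimer_config (hypercube d) [set [set x; flip x i] | x : V].
Proof.
apply: (dimer_config_of_involution (p := flip^~ i)) => x; first exact: flipK.
exact: hypercube_flip.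
Qed.

End Hypercube.

Import GRing.Theory Num.Theory.
Local Open Scope ring_scope.

Theorem theorem1p5 (R : realType) (d : nat) (hd : (3 <= d)%N) :
  2 ^+ d / d%:R ^+ 4 <=
    (min_degree (dimer_graph (hypercube d) (d - 1)))%:R :> R /\
  (forall C : {set dimer_config (hypercube d)},
     C \in components (dimer_graph (hypercube d) (d - 1)) ->
     2 `^ (2 ^+ d / d%:R ^+ 4) <= #|C|%:R :> R).
Proof.
have [S [S_ge S_far]] := exists_code hd.
have le_S : 2 ^+ d / d%:R ^+ 4 <= #|S|%:R :> R.
  rewrite ler_pdivrMr; last by rewrite exprn_gt0 // ltr0n; apply: leq_trans hd.
  by rewrite -!natrX -natrM ler_nat.
have cycles (M : dimer_config (hypercube d)) : exists c : {ffun 'I_d -> bool} -> seq _,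
    {in S, forall v, [/\ size (c v) <= 2 * (d - 1),
      is_cycle (hypercube d) (c v) & alternating (dimers M) (c v)]%N} /\
    {in S &, forall u v, u != v -> forall x, x \in c u -> x \notin c v}.
  have /fin_all_exists[c cP] v := local_cycle M v hd.
  exists c; split=> [v _|u v uS vS uv x xu]; first by case: (cP v).
  (* A common vertex would put [u] and [v] at distance at most 2 + 2 = 4. *)
  apply/negP=> xv; have := S_far u v uS vS uv; rewrite ltnNge => /negP; apply.
  apply: leq_trans (hdist_triangle x u v) _; rewrite (hdistC x v).
  by apply: (@leq_add _ _ 2 2); [have [_ _ _] := cP u | have [_ _ _] := cP v]; apply.
have degS M : (#|S| <= degree (dimer_graph (hypercube d) (d - 1)) M)%N.
  by have [c [cP c_disj]] := cycles M; apply: degree_ge_family cP c_disj.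
split=> [|C /imsetP[M _ ->]].
  apply: Order.POrderTheory.le_trans le_S _; rewrite ler_nat /min_degree.
  (* The minimum starts from the number of all configurations. That this number is at least [#|S|]
     follows from the degree of one concrete configuration. *)
  have M := DimerConfig (parallel_dimer_config (Ordinal (ltnW (ltnW hd)))).
  elim/big_rec: _ => [|N m _ Sm]; last by rewrite leq_min degS.
  exact: leq_trans (degS M) (max_card _).
(* Passing to the integer exponent [#|S|] turns the real power into a natural one. *)
apply: (@Order.POrderTheory.le_trans _ _ (2 `^ #|S|%:R)); first by rewrite ler_powR // ler1n.
rewrite powR_mulrn // -natrX ler_nat.
have [c [cP c_disj]] := cycles M.
apply: leq_trans (component_ge_family cP c_disj) _.
by apply: subset_leq_card; apply/subsetP=> N; rewrite !inE.
Qed.
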